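(* Let $T$ be a tree in $\mathcal{G}$. Then $T$ has a 4-pc decomposition or $T$ is a skeleton.
   Context: All graphs are finite and simple. The length of a path or cycle is its number of edges; a $k$-path is a path with $k$ edges. A decomposition of a graph is a collection of subgraphs such that each edge lies in exactly one of them; a 4-pc decomposition is a decomposition into paths and cycles each of length at least $4$. A vertex is odd if its degree is odd. The odd distance of $G$ is the minimum distance in $G$ between two distinct odd vertices. $\mathcal{G}$ denotes the set of all connected triangle-free graphs with odd distance at least $3$. Skeleton: a tree $T$ is a skeleton if there exist a coloring $\lambda:V(T)\to\{\text{black},\text{red}\}$, trees $T_0,\dots,T_t$ ($t\ge 0$) and paths $P_1,\dots,P_t$ such that: $T_0=x_0x_1x_2x_3$ is a $3$-path with $x_0,x_3$ black and $x_1,x_2$ red; $T_t=T$; each $P_i=x_0x_1\cdots x_k$ has $k\in\{4,6\}$, and $T_i$ is obtained from $T_{i-1}$ by adding $P_i$ so that its middle vertex $x_{k/2}$ (the joint of $P_i$) is identified with a vertex of $T_{i-1}$ (and $P_i$ is otherwise disjoint from $T_{i-1}$); in $P_i$ the vertices $x_0,x_k$ are black, $x_1,x_{k-1}$ are red, if $k=4$ then $x_2$ is red, and if $k=6$ then $x_3$ is black and $x_2,x_4$ are red. *)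

(* Defs.v *)
From mathcomp Require Import all_boot.

Set Implicit Arguments.
Unset Strict Implicit.
Unset Printing Implicit Defensive.

Record sgraph := SGraph {
  vertex :> finType;
  adj : rel vertex;
  adj_sym : symmetric adj;
  adj_irrefl : irreflexive adj }.

Section Graph.
Variable G : sgraph.
Implicit Types (x y z : G) (s : seq G).

Definition edges : {set {set G}} := [set [set p.1; p.2] | p : G * G & adj p.1 p.2].

Definition degree x : nat := #|[set y | adj x y]|.

Definition odd_vertex x : bool := odd (degree x).

Definition connected : Prop := 0 < #|G| /\ forall x y, connect (@adj G) x y.

Definition acyclic : Prop :=
  forall s, ~~ [&& 2 < size s, uniq s & cycle (@adj G) s].

Definition is_tree : Prop := connected /\ acyclic.

Definition triangle_free : Prop :=
  forall x y z, ~~ [&& adj x y, adj y z & adj z x].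

(* Least length of a path from x to y; it is the junk value #|G| when no such
   path exists, since a path has fewer than #|G| edges. *)
Definition dist x y : nat :=
  find (fun k => [exists p : k.-tuple G,
                    [&& path (@adj G) x p, last x p == y & uniq (x :: p)]])
       (iota 0 #|G|).

Definition odd_pair (p : G * G) : bool :=
  [&& odd_vertex p.1, odd_vertex p.2 & p.1 != p.2].

(* None stands for an infinite value: there are no two distinct odd vertices. *)
Definition odd_distance : option nat :=
  if [pick p | odd_pair p] is Some p0 then
    let p := [arg min_(p < p0 | odd_pair p) dist p.1 p.2] in
    Some (dist p.1 p.2)
  else None.

Definition odd_distance_geq (k : nat) : Prop :=
  if odd_distance is Some d then k <= d else True.

(* The class of all connected triangle-free graphs with odd distance >= 3. *)
Definition in_calG : Prop :=
  [/\ connected, triangle_free & odd_distance_geq 3].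

(* Pairs (vertex set, edge set); see is_subgraph for well-formedness. *)
Definition subgraph : finType := ({set G} * {set {set G}})%type.
Implicit Types H : subgraph.

Definition is_subgraph H : Prop :=
  H.2 \subset edges /\ forall f, f \in H.2 -> f \subset H.1.

Definition whole_graph : subgraph := ([set: G], edges).

Definition union_graph H1 H2 : subgraph := (H1.1 :|: H2.1, H1.2 :|: H2.2).

Definition path_graph s : subgraph :=
  ([set x in s], [set [set p.1; p.2] | p in zip s (behead s)]).

Definition cycle_graph s : subgraph :=
  ([set x in s], [set [set x; next s x] | x in s]).

Definition is_kpath (k : nat) H : Prop :=
  exists s, [/\ uniq s, size s = k.+1 & H = path_graph s].

Definition is_kcycle (k : nat) H : Prop :=
  exists s, [/\ uniq s, size s = k, 2 < k & H = cycle_graph s].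

Definition decomposition (D : {set subgraph}) : Prop :=
  (forall H, H \in D -> is_subgraph H) /\
  (forall f, f \in edges -> exists! H, H \in D /\ f \in H.2).

Definition has_4pc_decomposition : Prop :=
  exists D : {set subgraph}, decomposition D /\
    forall H, H \in D -> exists2 k, 4 <= k & is_kpath k H \/ is_kcycle k H.

Inductive color := black | red.

(* H' arises from H by adding the path s, identified with H exactly at the
   middle vertex of s, whose colours are as prescribed for 4- and 6-paths. *)
Definition attach (lambda : G -> color) H s H' : Prop :=
  exists (k : nat) (joint : G),
    [/\ uniq s,
        k = 4 /\ map lambda s = [:: black; red; red; red; black] \/
        k = 6 /\ map lambda s = [:: black; red; red; black; red; red; black],
        onth s k./2 = Some joint,
        H.1 :&: [set x in s] = [set joint]
      & H' = union_graph H (path_graph s)].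

(* The trees T_0, ..., T_t are realised as an increasing chain of subgraphs of
   G; they and the P_i lie in G because T_t = G. *)
Definition is_skeleton : Prop :=
  is_tree /\
  exists (lambda : G -> color) (t : nat) (Ts : nat -> subgraph)
         (Ps : nat -> seq G),
    [/\ exists s, [/\ uniq s, map lambda s = [:: black; red; red; black]
                    & Ts 0 = path_graph s],
        forall i, 1 <= i <= t -> attach lambda (Ts i.-1) (Ps i) (Ts i)
      & Ts t = whole_graph].

End Graph.

Arguments is_tree G : clear implicits.
Arguments in_calG G : clear implicits.
Arguments has_4pc_decomposition G : clear implicits.
Arguments is_skeleton G : clear implicits.

(* Main.v *)
(** If the tree is not a path, a branch vertex [v] farthest from a root carries
    at least [deg v - 1 >= 2] pendant paths.  Removing two of them, of lengths
    [p >= q], keeps all degree parities, and sparsity of the odd vertices lets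
    us choose them with [p + q >= 4], and with [q >= 3] if [v] is odd.  By
    induction the rest [T'] is long-decomposable, and then so is [T], or it is
    a skeleton.  In a skeleton, every vertex [v] can be put on the 3-path of a
    decomposition into one 3-path and paths of length at least 4, as an end if
    [v] is black and as an inner vertex if [v] is red.  Gluing the two removed
    paths to the two sides of [v] on that 3-path gives a decomposition of [T],
    except when [p = q = 3] with [v] black or [p = q = 2] with [v] red, where
    [T] is again a skeleton, and when [q = 1], which is impossible because a red
    vertex of a skeleton always has a black neighbour. *)
From mathcomp Require Import all_boot zify.
Require Import Defs.

Set Implicit Arguments.
Unset Strict Implicit.
Unset Printing Implicit Defensive.

(** * Edge lists of vertex sequences *)

Section PathEdges.
Variable T : finType.
Implicit Types (x y v w : T) (s a b : seq T) (f : {set T}).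

(** A list rather than a set, so that edge-disjointness of several paths can be expressed by
    [perm_eq] and verified by counting. *)
Definition pedges s : seq {set T} := [seq [set p.1; p.2] | p <- zip s (behead s)].

Lemma set2_inj x y z : [set x; y] = [set x; z] -> y = z.
Proof.
move=> e; have: y \in [set x; z] by rewrite -e set22.
rewrite !inE => /orP[/eqP yx|/eqP //]; have: z \in [set x; y] by rewrite e set22.
by rewrite !inE yx orbb => /eqP.
Qed.

Lemma pedges_cons2 x y s : pedges [:: x, y & s] = [set x; y] :: pedges (y :: s).
Proof. by []. Qed.

Lemma pedges_cat a x b : pedges (a ++ x :: b) = pedges (rcons a x) ++ pedges (x :: b).
Proof.
elim: a => [|y [|z a] IH] //.
by rewrite !(cat_cons, rcons_cons, pedges_cons2) -cat_cons IH rcons_cons.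
Qed.

Lemma perm_pedges_rev s : perm_eq (pedges (rev s)) (pedges s).
Proof.
elim: s => [|x [|y s] IH] //.
rewrite pedges_cons2 !rev_cons -!cats1 -catA /= pedges_cat -rev_cons.
by rewrite pedges_cons2 [[set y; x]]setUC cats1 perm_rcons perm_cons.
Qed.

Lemma mem_pedges_rev s : pedges (rev s) =i pedges s.
Proof. exact: perm_mem (perm_pedges_rev s). Qed.

Lemma pedgesP f s :
  f \in pedges s -> exists a x y b, s = a ++ [:: x, y & b] /\ f = [set x; y].
Proof.
elim: s => [|x [|y s] IH] //; rewrite pedges_cons2 inE => /predU1P[->|/IH].
  by exists [::], x, y, s.
by case=> [a [x' [y' [b [-> ->]]]]]; exists (x :: a), x', y', b.
Qed.

Lemma pedges_sub f s : f \in pedges s -> {subset f <= s}.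
Proof.
case/pedgesP=> [a [x [y [b [-> ->]]]]] z; rewrite !inE mem_cat !inE.
by case/orP=> ->; rewrite ?orbT.
Qed.

Lemma mem_pedges_mid a x y b : [set x; y] \in pedges (a ++ [:: x, y & b]).
Proof. by rewrite pedges_cat mem_cat pedges_cons2 mem_head orbT. Qed.

Lemma uniq_pedges s : uniq s -> uniq (pedges s).
Proof.
elim: s => [|x [|y s] IH] //; rewrite pedges_cons2 [uniq (x :: _)]/= => /andP[xN us].
rewrite cons_uniq IH // andbT; apply: contra xN => /pedges_sub; apply.
by rewrite set21.
Qed.

(** In [rev a ++ v :: b] both arms are listed outward from [v]. Every regluing of arms at a common
    vertex reduces through this identity to linear arithmetic on counts. *)
Lemma count_pedges_join (P : pred {set T}) a v b :
  count P (pedges (rev a ++ v :: b)) =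
  count P (pedges (v :: a)) + count P (pedges (v :: b)).
Proof.
rewrite pedges_cat count_cat -rev_cons; congr (_ + _).
exact/permP/perm_pedges_rev.
Qed.

Lemma pedges_head v w s y : uniq [:: v, w & s] ->
  [set v; y] \in pedges [:: v, w & s] -> y = w.
Proof.
rewrite pedges_cons2 inE => /andP[vN _] /predU1P[/set2_inj //|/pedges_sub sub].
by case/negP: vN; apply: sub; rewrite set21.
Qed.

Lemma pedges_last w s y : uniq (rcons s w) ->
  [set w; y] \in pedges (rcons s w) -> y \in s /\ y = last y s.
Proof.
case/lastP: s => [|s u] // us; rewrite -mem_pedges_rev !rev_rcons => yP.
have /= -> : y = u by apply: pedges_head yP; rewrite -!rev_rcons rev_uniq.
by rewrite last_rcons mem_rcons mem_head.
Qed.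

Lemma uniq_cat_out (A : {pred T}) a b : uniq a -> uniq b ->
  {in a, forall x, x \notin A} -> {subset b <= A} -> uniq (a ++ b).
Proof.
move=> ua ub aA bA; rewrite cat_uniq ua ub /= andbT; apply/hasPn => x /bA xA.
by apply/negP => /aA; rewrite xA.
Qed.

Lemma uniq_flatten_pedges (L : seq (seq T)) s1 s2 f :
  uniq (flatten (map pedges L)) -> s1 \in L -> s2 \in L ->
  f \in pedges s1 -> f \in pedges s2 -> s1 = s2.
Proof.
have mf s M : s \in M -> f \in pedges s -> f \in flatten (map pedges M).
  by move=> sM fs; apply/flattenP; exists (pedges s) => //; apply: map_f.
elim: L => //= s L IH; rewrite cat_uniq => /and3P[_ /hasPn D uL].
rewrite !inE => /predU1P[->|s1L] /predU1P[->|s2L] // f1 f2; last exact: IH.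
  by case/negP: (D _ (mf _ _ s2L f2)).
by case/negP: (D _ (mf _ _ s1L f1)).
Qed.

End PathEdges.

(** * Skeletons as subgraphs, and their decompositions with one 3-path *)

Section Skeletons.
Variable G : sgraph.
Implicit Types (H : subgraph G) (x y v j : G) (s : seq G) (L : seq (seq G)).
Variable odd_set : {pred G}.

(* Attaching a path at its middle preserves degree parities, so the black
   vertices of a skeleton are its odd ones and the colouring is forced. *)
Definition odd_color x : color := if x \in odd_set then black else red.

(** The chain of trees in [is_skeleton] as an inductive predicate, with the colouring fixed to
    [odd_color]. *)
Inductive skel : subgraph G -> Prop :=
| skel_base s : uniq s -> map odd_color s = [:: black; red; red; black] ->
    skel (path_graph s)
| skel_attach H s H' : skel H -> attach odd_color H s H' -> skel H'.

Definition long_paths L := all (fun s => uniq s && (4 < size s)) L.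

(** Since [enum] has no duplicates, the permutation gives covering and edge-disjointness at once. *)
Definition edge_partition L H : Prop :=
  perm_eq (flatten (map (@pedges G) L)) (enum H.2).

(* The remainder of an otherwise long decomposition is a 3-path through [v]
   of which [v] is an end or an inner vertex according to its colour. *)
Definition short_at v H : Prop := exists x0 x1 x2 x3 L,
  [/\ uniq [:: x0; x1; x2; x3], {subset [:: x0; x1; x2; x3] <= H.1},
      long_paths L, edge_partition ([:: x0; x1; x2; x3] :: L) H
    & v = if v \in odd_set then x0 else x1].

Lemma count_edges_cons (Q : pred {set G}) s L :
  count Q (flatten (map (@pedges G) (s :: L))) =
  count Q (pedges s) + count Q (flatten (map (@pedges G) L)).
Proof. by rewrite /= count_cat. Qed.

Lemma count_partition (Q : pred {set G}) L H : edge_partition L H ->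
  count Q (enum H.2) = count Q (flatten (map (@pedges G) L)).
Proof. by move/permP->. Qed.

Lemma mem_path_graph s (f : {set G}) : (f \in (path_graph s).2) = (f \in pedges s).
Proof.
apply/imsetP/mapP => [[p pz ->]|[p pz ->]]; first by exists p.
by exists p.
Qed.

Lemma path_graph_rev s : path_graph (rev s) = path_graph s.
Proof.
apply: injective_projections; apply/setP => x; first by rewrite !inE mem_rev.
by rewrite !mem_path_graph mem_pedges_rev.
Qed.

Definition edges_inside H := forall f : {set G}, f \in H.2 -> f \subset H.1.

Lemma edges_inside_path s : edges_inside (path_graph s).
Proof. by move=> f; rewrite mem_path_graph => /pedges_sub fs; apply/subsetP => x /fs; rewrite inE. Qed.

Lemma edges_inside_union H H' :
  edges_inside H -> edges_inside H' -> edges_inside (union_graph H H').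
Proof.
move=> HH HH' f; rewrite inE => /orP[/HH|/HH'] sub; apply: subset_trans sub _.
  exact: subsetUl.
exact: subsetUr.
Qed.

(** A path through [j] that meets [H] only there. Unlike in [attach], the two sides may have
    different lengths. *)
Definition arms H j a b : Prop :=
  [/\ j \in H.1, uniq (rev a ++ j :: b) & {in a ++ b, forall x, x \notin H.1}].

Lemma armsC H j a b : arms H j a b -> arms H j b a.
Proof.
case=> jH u D; split=> //; last by move=> x; rewrite mem_cat orbC -mem_cat; apply: D.
by rewrite -rev_uniq rev_cat rev_cons revK cat_rcons.
Qed.

(** An edge shared by [H] and the new path would have both ends in [H.1], hence both equal to [j],
    against [uniq]. *)
Lemma count_arms H j a b (P : pred {set G}) : edges_inside H -> arms H j a b ->
  count P (enum (union_graph H (path_graph (rev a ++ j :: b))).2) =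
  count P (enum H.2) + count P (pedges (j :: a)) + count P (pedges (j :: b)).
Proof.
move=> HH [jH u D]; rewrite -addnA -count_pedges_join -count_cat.
set s := rev a ++ j :: b in u *.
apply/permP/uniq_perm; first exact: enum_uniq.
  rewrite cat_uniq enum_uniq uniq_pedges // andbT /=; apply/hasPn => f.
  case/pedgesP => [c [x [y [d [sE ->]]]]]; rewrite mem_enum; apply/negP => /HH.
  have inj z : z \in s -> z \in H.1 -> z = j.
    rewrite mem_cat mem_rev inE orbCA => /predU1P[//|]; rewrite -mem_cat => /D.
    by move=> /negP.
  rewrite subUset !sub1set => /andP[xH yH]; move: u.
  have xs : x \in c ++ [:: x, y & d] by rewrite mem_cat mem_head orbT.
  have ys : y \in c ++ [:: x, y & d] by rewrite mem_cat !inE eqxx !orbT.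
  rewrite -sE in xs ys; have yx : y = x by rewrite (inj x xs xH) (inj y ys yH).
  by rewrite sE yx cat_uniq /= inE eqxx !andbF.
by move=> f; rewrite mem_cat !mem_enum inE mem_path_graph.
Qed.

(** The colours already fit the positions: the path itself serves [x0] and [x1], its reversal serves
    [x3] and [x2]. *)
Lemma short_at_three_path H x0 x1 x2 x3 L :
  uniq [:: x0; x1; x2; x3] -> {subset [:: x0; x1; x2; x3] <= H.1} ->
  long_paths L -> edge_partition ([:: x0; x1; x2; x3] :: L) H ->
  map odd_color [:: x0; x1; x2; x3] = [:: black; red; red; black] ->
  {in [:: x0; x1; x2; x3], forall v, short_at v H}.
Proof.
move=> u sub gL P col v vx; have [c0 c1 c2 c3] : [/\ x0 \in odd_set, x1 \notin odd_set, x2 \notin odd_set & x3 \in odd_set].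
  by move: col; rewrite /odd_color /=; do 4 case: (_ \in odd_set).
have u' : uniq [:: x3; x2; x1; x0] by rewrite -[X in uniq X]/(rev [:: x0; x1; x2; x3]) rev_uniq.
have sub' : {subset [:: x3; x2; x1; x0] <= H.1} by move=> y yx; apply: sub; rewrite -mem_rev.
have P' : edge_partition ([:: x3; x2; x1; x0] :: L) H.
  rewrite /edge_partition -(permPr P) /=.
  exact: (perm_cat (perm_pedges_rev [:: x0; x1; x2; x3]) (perm_refl _)).
move: vx; rewrite !inE => /or4P[]/eqP->.
- by exists x0, x1, x2, x3, L; rewrite c0.
- by exists x0, x1, x2, x3, L; rewrite (negPf c1).
- by exists x3, x2, x1, x0, L; rewrite (negPf c2).
- by exists x3, x2, x1, x0, L; rewrite c3.
Qed.

(** The 3-path [x0 j x2 x3] and the new 4-path exchange halves at [j]: they become the 3-path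
    [a2 a1 j x0] and the 4-path [b2 b1 j x2 x3]. *)
Lemma short_at_arms2 H j a1 a2 b1 b2 L x0 x2 x3 (s := [:: a2; a1; j; b1; b2]) :
  edges_inside H -> arms H j [:: a1; a2] [:: b1; b2] ->
  a1 \notin odd_set -> a2 \in odd_set ->
  uniq [:: x0; j; x2; x3] -> {subset [:: x0; j; x2; x3] <= H.1} ->
  long_paths L -> edge_partition ([:: x0; j; x2; x3] :: L) H ->
  {in [:: a1; a2], forall v, short_at v (union_graph H (path_graph s))}.
Proof.
move=> HH A c1 c2 u sub gL P v va; have [jH us D] := A.
exists a2, a1, j, x0, ([:: b2; b1; j; x2; x3] :: L); split.
- apply: (@uniq_cat_out _ (mem H.1) [:: a2; a1] [:: j; x0]).
  + by case: A => _; rewrite cat_uniq => /andP[].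
  + by move: u; rewrite /= !inE !negb_or (eq_sym j x0) => /andP[/andP[->]].
  + by move=> y; rewrite !inE => /orP[]/eqP->; apply: D; rewrite !inE eqxx ?orbT.
  + by move=> y; rewrite !inE => /orP[]/eqP->; apply: sub; rewrite !inE eqxx ?orbT.
- move=> y; rewrite !inE => /or4P[]/eqP->; rewrite ?eqxx ?orbT //.
  by rewrite sub ?inE ?eqxx.
- rewrite /= -/(long_paths L) gL andbT.
  apply/andP; split=> //; apply: (@uniq_cat_out _ (mem H.1) [:: b2; b1] [:: j; x2; x3]).
  + by case: (armsC A) => _; rewrite cat_uniq => /andP[].
  + by move: u => /= /andP[].
  + by move=> y; rewrite !inE => /orP[]/eqP->; apply: D; rewrite !inE eqxx ?orbT.
  + by move=> y yi; apply: sub; rewrite inE yi orbT.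
- apply/permP => Q; rewrite (count_arms _ HH A) (count_partition _ P) !count_edges_cons.
  have cj := count_pedges_join Q.
  rewrite (cj [:: a1; a2] j [:: x0]) (cj [:: b1; b2] j [:: x2; x3]).
  rewrite (cj [:: x0] j [:: x2; x3]); lia.
by move: va; rewrite !inE => /orP[]/eqP->; rewrite ?c2 // (negPf c1).
Qed.

(** Here [j] is an end of the old 3-path. The arm [j a1 a2 a3] becomes the new 3-path, and the other
    arm continues along the old one as the 6-path [b3 b2 b1 j x1 x2 x3]. *)
Lemma short_at_arms3 H j a1 a2 a3 b1 b2 b3 L x1 x2 x3
    (s := [:: a3; a2; a1; j; b1; b2; b3]) :
  edges_inside H -> arms H j [:: a1; a2; a3] [:: b1; b2; b3] ->
  map odd_color [:: j; a1; a2; a3] = [:: black; red; red; black] ->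
  uniq [:: j; x1; x2; x3] -> {subset [:: j; x1; x2; x3] <= H.1} ->
  long_paths L -> edge_partition ([:: j; x1; x2; x3] :: L) H ->
  {in [:: a1; a2; a3], forall v, short_at v (union_graph H (path_graph s))}.
Proof.
move=> HH A col u sub gL P v va; have [jH us D] := A.
apply: (@short_at_three_path _ j a1 a2 a3 ([:: b3; b2; b1; j; x1; x2; x3] :: L)) => //.
- by move: us; rewrite -cat_rcons -rev_cons cat_uniq rev_uniq => /andP[].
- by move=> y; rewrite !inE => /or4P[]/eqP->; rewrite eqxx ?orbT.
- rewrite /= -/(long_paths L) gL andbT.
  apply/andP; split=> //; apply: (@uniq_cat_out _ (mem H.1) [:: b3; b2; b1] [:: j; x1; x2; x3]) => //.
  + by case: (armsC A) => _; rewrite cat_uniq => /andP[].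
  + by move=> y yb; apply: D; rewrite mem_cat -[y \in [:: b1; b2; b3]]mem_rev yb orbT.
- apply/permP => Q; rewrite (count_arms _ HH A) (count_partition _ P) !count_edges_cons.
  rewrite (count_pedges_join Q [:: b1; b2; b3] j [:: x1; x2; x3]); lia.
by rewrite inE va orbT.
Qed.

Lemma odd_color_black x : odd_color x = black -> x \in odd_set.
Proof. by rewrite /odd_color; case: (x \in _). Qed.

Lemma odd_color_red x : odd_color x = red -> x \notin odd_set.
Proof. by rewrite /odd_color; case: (x \in _). Qed.

(** Splits the attached path at its joint: a 4-path gives arms of length 2 at a red joint, a 6-path
    arms of length 3 at a black one. *)
Lemma attach_arms H s H' : attach odd_color H s H' -> exists j a b,
  [/\ arms H j a b, s = rev a ++ j :: b, H' = union_graph H (path_graph s)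
    & [/\ map odd_color a = [:: red; black], map odd_color b = [:: red; black]
        & j \notin odd_set] \/
      [/\ map odd_color a = [:: red; red; black],
          map odd_color b = [:: red; red; black] & j \in odd_set]].
Proof.
case=> k [j [us kc sj sH ->]].
have D x : x \in s -> x \in H.1 -> x = j.
  by move=> xs xH; apply/eqP; rewrite -in_set1 -sH !inE xH xs.
have jH : j \in H.1 by have:= set11 j; rewrite -sH inE => /andP[].
have fresh a b : s = rev a ++ j :: b -> arms H j a b.
  move=> sE; split=> //; first by rewrite -sE.
  move=> x; rewrite mem_cat -mem_rev => xab; apply/negP => xH.
  have xj : x = j by apply: D; rewrite ?sE ?mem_cat ?inE //; case/orP: xab => ->; rewrite ?orbT.
  by move: us; rewrite sE uniq_catC cons_uniq mem_cat orbC -xj xab.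
case: kc => [] [kE sc]; move: sc sj fresh; rewrite kE.
  case: s us sH D => [|a2 [|a1 [|j' [|b1 [|b2 []]]]]] //= us sH D.
  case=> ca2 ca1 cj cb1 cb2 [<-] fresh; exists j', [:: a1; a2], [:: b1; b2]; split=> //.
    exact: fresh.
  by left; rewrite /= ca1 ca2 cb1 cb2 odd_color_red.
case: s us sH D => [|a3 [|a2 [|a1 [|j' [|b1 [|b2 [|b3 []]]]]]]] //= us sH D.
case=> ca3 ca2 ca1 cj cb1 cb2 cb3 [<-] fresh; exists j', [:: a1; a2; a3], [:: b1; b2; b3]; split=> //.
  exact: fresh.
by right; rewrite /= ca1 ca2 ca3 cb1 cb2 cb3 odd_color_black.
Qed.

Lemma arms_attach H j a b : arms H j a b ->
  [/\ map odd_color a = [:: red; black], map odd_color b = [:: red; black]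
    & j \notin odd_set] \/
  [/\ map odd_color a = [:: red; red; black],
      map odd_color b = [:: red; red; black] & j \in odd_set] ->
  attach odd_color H (rev a ++ j :: b) (union_graph H (path_graph (rev a ++ j :: b))).
Proof.
case=> jH us D col.
have sH : H.1 :&: [set x in rev a ++ j :: b] = [set j].
  apply/setP => x; rewrite !inE mem_cat mem_rev inE orbCA -mem_cat.
  case: eqVneq => [->|_] /=; first by rewrite jH.
  by apply/negP => /andP[xH /D]; rewrite xH.
have cat_col : map odd_color (rev a ++ j :: b) =
    rev (map odd_color a) ++ odd_color j :: map odd_color b.
  by rewrite map_cat map_rev.
have sz : size a = size (map odd_color a) by rewrite size_map.
case: col => [] [ca cb cj].
  exists 4, j; split=> //; first by left; rewrite cat_col ca cb /odd_color (negPf cj).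
  by rewrite onth_cat size_rev sz ca.
exists 6, j; split=> //; first by right; rewrite cat_col ca cb /odd_color cj.
by rewrite onth_cat size_rev sz ca.
Qed.

(** Induction on the construction. The second property feeds the regluing at a branch vertex; the
    third rules out a pendant edge at a red vertex. *)
Lemma skel_properties H : skel H ->
  [/\ edges_inside H, {in H.1, forall v, short_at v H}
    & {in H.1, forall v, v \notin odd_set ->
        exists2 b, b \in odd_set & (b \in H.1) && ([set v; b] \in H.2)}].
Proof.
elim=> {H} [s us col|H s H' _ [HH sh bl] /attach_arms [j [a [b [A sE H'E col]]]]].
  split; first exact: edges_inside_path.
    case: s us col => [|x0 [|x1 [|x2 [|x3 []]]]] // us col v; rewrite inE => vs.
    apply: (@short_at_three_path _ x0 x1 x2 x3 [::]) => //; first by move=> y ys; rewrite inE.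
    rewrite /edge_partition [flatten _]cats0; apply: uniq_perm; rewrite ?enum_uniq ?uniq_pedges // => f.
    by rewrite mem_enum mem_path_graph.
  case: s us col => [|x0 [|x1 [|x2 [|x3 []]]]] // us [c0 c1 c2 c3] v; rewrite !inE => vs vN.
  have [c0' c3'] : x0 \in odd_set /\ x3 \in odd_set by split; apply: odd_color_black.
  move: vs vN => /or4P[]/eqP->; rewrite ?c0' ?c3' // => _.
    by exists x0 => //; rewrite !inE eqxx mem_path_graph !pedges_cons2 setUC inE eqxx.
  by exists x3 => //; rewrite !inE eqxx !orbT mem_path_graph !pedges_cons2 !inE eqxx !orbT.
have [jH us D] := A; rewrite H'E; split.
- by apply: edges_inside_union => //; apply: edges_inside_path.
- have [x0 [x1 [x2 [x3 [L [u sub gL P jE]]]]]] := sh j jH.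
  move=> v; rewrite !inE sE mem_cat mem_rev inE (orbCA (v \in a)); case: (boolP (v \in H.1)) => [vH _|vN].
    (* An old vertex keeps its 3-path; the attached path, of length 4 or 6, joins the long paths. *)
    have [y0 [y1 [y2 [y3 [M [u' sub' gM P' vE]]]]]] := sh v vH.
    exists y0, y1, y2, y3, ((rev a ++ j :: b) :: M); split=> //.
    + by move=> y /sub' yH; rewrite inE yH.
    + rewrite /= -/(long_paths M) gM us size_cat size_rev -(size_map odd_color a).
      by rewrite /= -(size_map odd_color b); case: col => [] [-> ->].
    + apply/permP => Q; rewrite (count_arms _ HH A) (count_partition _ P') !count_edges_cons.
      rewrite count_pedges_join; lia.
  rewrite /= => /predU1P[vj|]; first by rewrite vj jH in vN.
  rewrite -mem_cat; case: col => [] [ca cb cj].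
    case: a ca A us D sE => [|a1 [|a2 []]] // [ca1 ca2] A us D sE.
    case: b cb A us D sE => [|b1 [|b2 []]] // [cb1 cb2] A us D sE.
    move: u sub P; rewrite (negPf cj) in jE; rewrite -jE => u sub P.
    rewrite mem_cat => /orP[va|vb].
      by apply: (short_at_arms2 HH A _ _ u sub gL P) va; [apply: odd_color_red | apply: odd_color_black].
    (* The arms play symmetric roles, so the other arm is handled by reading the attached path
       backwards. *)
    have -> : union_graph H (path_graph (rev [:: a1; a2] ++ [:: j; b1; b2])) =
              union_graph H (path_graph [:: b2; b1; j; a1; a2]).
      by congr union_graph; rewrite -path_graph_rev.
    by apply: (short_at_arms2 HH (armsC A) _ _ u sub gL P) vb; [apply: odd_color_red | apply: odd_color_black].
  case: a ca A us D sE => [|a1 [|a2 [|a3 []]]] // [ca1 ca2 ca3] A us D sE.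
  case: b cb A us D sE => [|b1 [|b2 [|b3 []]]] // [cb1 cb2 cb3] A us D sE.
  have cj' : odd_color j = black by rewrite /odd_color cj.
  move: u sub P; rewrite cj in jE; rewrite -jE => u sub P.
  rewrite mem_cat => /orP[va|vb].
    by apply: (short_at_arms3 HH A _ u sub gL P) va; rewrite /= cj' ca1 ca2 ca3.
  have -> : union_graph H (path_graph (rev [:: a1; a2; a3] ++ [:: j; b1; b2; b3])) =
            union_graph H (path_graph [:: b3; b2; b1; j; a1; a2; a3]).
    by congr union_graph; rewrite -path_graph_rev.
  by apply: (short_at_arms3 HH (armsC A) _ u sub gL P) vb; rewrite /= cj' cb1 cb2 cb3.
move=> v; rewrite !inE => vs vN.
case: (boolP (v \in H.1)) vs => [vH _|vNH /= vs].
  by have [c cO /andP[cH ce]] := bl v vH vN; exists c; rewrite // !inE cH ce.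
suff [c cO ce] : exists2 c, c \in odd_set & [set v; c] \in pedges s.
  exists c => //; rewrite !inE (pedges_sub ce) ?set22 // orbT /=.
  by rewrite mem_path_graph ce orbT.
have vj : v != j by apply: contraNneq vNH => ->.
move: vs; rewrite sE; case: col => [] [ca cb cj].
  case: a ca A us D sE => [|a1 [|a2 []]] // [ca1 ca2] A us D sE.
  case: b cb A us D sE => [|b1 [|b2 []]] // [cb1 cb2] A us D sE.
  have [a2O b2O] : a2 \in odd_set /\ b2 \in odd_set by split; apply: odd_color_black.
  rewrite /= !inE (negPf vj) /= => /or4P[]/eqP vE; move: vN; rewrite vE ?a2O ?b2O // => _.
    by exists a2; rewrite // setUC !pedges_cons2 !inE eqxx.
  by exists b2; rewrite // !pedges_cons2 !inE eqxx ?orbT.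
case: a ca A us D sE => [|a1 [|a2 [|a3 []]]] // [ca1 ca2 ca3] A us D sE.
case: b cb A us D sE => [|b1 [|b2 [|b3 []]]] // [cb1 cb2 cb3] A us D sE.
have [a3O b3O] : a3 \in odd_set /\ b3 \in odd_set by split; apply: odd_color_black.
rewrite /= !inE (negPf vj) /= => vs.
have {}vs : v \in [:: a3; a2; a1; b1; b2; b3] by rewrite !inE.
(* The red vertices [a2] and [b2] see the black ends; [a1] and [b1] see the black joint. *)
move: vs vN; rewrite !inE => /predU1P[->|]; first by rewrite a3O.
case/predU1P=> [-> _|].
  by exists a3; rewrite // setUC !pedges_cons2 !inE eqxx.
case/predU1P=> [-> _|].
  by exists j; rewrite // !pedges_cons2 !inE eqxx ?orbT.
case/predU1P=> [-> _|].
  by exists j; rewrite // setUC !pedges_cons2 !inE eqxx ?orbT.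
case/predU1P=> [-> _|/eqP->]; last by rewrite b3O.
by exists b3; rewrite // !pedges_cons2 !inE eqxx ?orbT.
Qed.

(** * Extending decompositions by two arms, and translation back to the original definitions *)

Definition long_dec H := exists2 L, long_paths L & edge_partition L H.

Section Extension.
Variables (H : subgraph G) (j : G) (a b : seq G).
Hypotheses (HH : edges_inside H) (A : arms H j a b).
Let H' := union_graph H (path_graph (rev a ++ j :: b)).

Lemma long_dec_extend : 3 < size a + size b -> long_dec H -> long_dec H'.
Proof.
move=> sz [L gL P]; exists ((rev a ++ j :: b) :: L).
  case: A => _ us _; rewrite /= us gL andbT size_cat size_rev /=; lia.
apply/permP => Q; rewrite (count_arms _ HH A) (count_partition _ P) count_edges_cons.
rewrite count_pedges_join; lia.
Qed.

Lemma arm_uniq s : uniq s -> {subset s <= H.1} -> uniq (rev a ++ s) && uniq (rev b ++ s).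
Proof.
move=> us sub; have [_ ua D] := A; have [_ ub _] := armsC A.
apply/andP; split; apply: (@uniq_cat_out _ (mem H.1)) => //.
- by move: ua; rewrite cat_uniq => /andP[].
- by move=> x xa; apply: D; rewrite mem_cat -(mem_rev a) xa.
- by move: ub; rewrite cat_uniq => /andP[].
- by move=> x xb; apply: D; rewrite mem_cat -(mem_rev b) xb orbT.
Qed.

(** The arm [a] is a long path on its own, and [b] is glued to the 3-path at its end [j], giving
    length at least 4. *)
Lemma long_dec_black : j \in odd_set -> short_at j H -> 3 < size a -> 0 < size b ->
  long_dec H'.
Proof.
move=> jO [x0 [x1 [x2 [x3 [L [u sub gL P]]]]]]; rewrite jO => jE sa sb.
rewrite -{x0}jE in u sub P; have [jH us D] := A.
exists [:: j :: a, rev b ++ [:: j; x1; x2; x3] & L].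
  have /andP[_ ub] := arm_uniq u sub; rewrite [long_paths _]/= ub -/(long_paths L) gL.
  have -> : 4 < size (rev b ++ [:: j; x1; x2; x3]) by rewrite size_cat size_rev /=; lia.
  rewrite ltnS sa !andbT.
  by move: us; rewrite -cat_rcons -rev_cons cat_uniq rev_uniq => /andP[].
apply/permP => Q; rewrite (count_arms _ HH A) (count_partition _ P) !count_edges_cons.
rewrite count_pedges_join; lia.
Qed.

(** The inner vertex [j] cuts the 3-path into pieces of lengths 1 and 2; the first is glued to [a],
    the second to [b], and both results have length at least 4. *)
Lemma long_dec_red : j \notin odd_set -> short_at j H -> 2 < size a -> 1 < size b ->
  long_dec H'.
Proof.
move=> jO [x0 [x1 [x2 [x3 [L [u sub gL P]]]]]]; rewrite (negPf jO) => jE sa sb.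
rewrite -{x1}jE in u sub P.
exists [:: rev a ++ [:: j; x0], rev b ++ [:: j; x2; x3] & L].
  have /andP[ua _] : uniq (rev a ++ [:: j; x0]) && uniq (rev b ++ [:: j; x0]).
    apply: arm_uniq; first by move: u; rewrite /= !inE !negb_or (eq_sym j x0) => /andP[/andP[->]].
    by move=> y; rewrite !inE => /orP[]/eqP->; apply: sub; rewrite !inE eqxx ?orbT.
  have /andP[_ ub] : uniq (rev a ++ [:: j; x2; x3]) && uniq (rev b ++ [:: j; x2; x3]).
    apply: arm_uniq; first by move: u => /= /andP[].
    by move=> y yi; apply: sub; rewrite inE yi orbT.
  rewrite [long_paths _]/= ua ub -/(long_paths L) gL !size_cat !size_rev /=; lia.
apply/permP => Q; rewrite (count_arms _ HH A) (count_partition _ P) !count_edges_cons.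
have cj := count_pedges_join Q; rewrite !cj (cj [:: x0] j [:: x2; x3]); lia.
Qed.

End Extension.

Lemma skel_chain H : skel H -> exists t (Ts : nat -> subgraph G) (Ps : nat -> seq G),
  [/\ exists s, [/\ uniq s, map odd_color s = [:: black; red; red; black]
                  & Ts 0 = path_graph s],
      forall i, 1 <= i <= t -> attach odd_color (Ts i.-1) (Ps i) (Ts i)
    & Ts t = H].
Proof.
elim=> {H} [s us col|H s H' _ [t [Ts [Ps [T0 TA TH]]]] A].
  exists 0, (fun=> path_graph s), (fun=> [::]); split=> //; first by exists s.
  by case.
exists t.+1, (fun i => if i <= t then Ts i else H'), (fun i => if i <= t then Ps i else s).
split=> //; last by rewrite ltnn.
move=> i /andP[i0 it]; have [ti|ti] := leqP i t.
  by rewrite (leq_trans (leq_pred i) ti); apply: TA; rewrite i0.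
have -> : i = t.+1 by lia.
by rewrite leqnn TH.
Qed.

End Skeletons.

(** Every member of the decomposition is a path. Uniqueness of the member through an edge holds
    because the concatenated edge lists have no repetition. *)
Lemma long_dec_4pc (G : sgraph) : long_dec (whole_graph G) -> has_4pc_decomposition G.
Proof.
case=> L gL P; pose D := [set H in map (@path_graph G) L].
have memL (f : {set G}) : (f \in edges G) = (f \in flatten (map (@pedges G) L)).
  by rewrite (perm_mem P) mem_enum.
have inL s (f : {set G}) : s \in L -> f \in pedges s -> f \in edges G.
  by move=> sL fs; rewrite memL; apply/flattenP; exists (pedges s) => //; apply: map_f.
exists D; split; last first.
  move=> H; rewrite inE => /mapP[s sL ->]; have /andP[us sz] := allP gL s sL.
  exists (size s).-1; first by rewrite -ltnS prednK // (leq_trans _ sz).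
  by left; exists s; rewrite prednK // (leq_trans _ sz).
split=> [H|f].
  rewrite inE => /mapP[s sL ->]; split; last exact: edges_inside_path.
  by apply/subsetP => f; rewrite mem_path_graph; apply: inL.
rewrite memL => /flattenP[_ /mapP[s sL ->] fs]; exists (path_graph s); split.
  by rewrite inE mem_path_graph map_f.
move=> H' []; rewrite inE => /mapP[s' s'L ->]; rewrite mem_path_graph => fs'.
congr path_graph; apply: uniq_flatten_pedges sL s'L fs fs'.
by have := perm_uniq P; rewrite enum_uniq.
Qed.

(** * Induced subgraphs, paths inside them and pendant paths *)

Section InducedSubgraphs.
Variable G : sgraph.
Implicit Types (S A : {set G}) (x y v w : G) (s c : seq G).

Definition induced S : subgraph G := (S, [set f in edges G | f \subset S]).

Definition neighbors S x := [set y in S | adj x y].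

(** Connectivity as a closure property: no proper non-empty part of [S] is closed under adjacency.
    This form survives vertex removal without manipulating walks. *)
Definition connected_in S := S != set0 /\ forall A, A != set0 -> A \subset S ->
  (forall x y, x \in A -> y \in S -> adj x y -> y \in A) -> A = S.

Definition spath S c := [&& uniq c, sorted (@adj G) c & all (mem S) c].

(** The last clause says that no edge inside [S] leaves [s] except along the path; the attaching
    vertex [v] may have further neighbours. *)
Definition pendant S v s : Prop :=
  [/\ v \in S, uniq (v :: s), path (@adj G) v s, {subset s <= S}
    & forall x y, x \in s -> y \in S -> adj x y -> [set x; y] \in pedges (v :: s)].

Lemma mem_neighbors S x y : (y \in neighbors S x) = (y \in S) && adj x y.
Proof. exact: in_set. Qed.

Lemma adj_neq x y : adj x y -> x != y.
Proof. by apply: contraTneq => ->; rewrite adj_irrefl. Qed.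

Lemma mem_edges x y : ([set x; y] \in edges G) = adj x y.
Proof.
apply/imsetP/idP => [[[u w]]|xy]; last by exists (x, y); rewrite ?inE.
rewrite inE /= => uw e; have: x \in [set u; w] by rewrite -e set21.
rewrite !inE => /orP[]/eqP xE; rewrite xE in e *; first by rewrite (set2_inj e).
by rewrite [RHS]setUC in e; rewrite (set2_inj e) adj_sym.
Qed.

Lemma edges_set2 f : f \in edges G -> exists x y, f = [set x; y] /\ adj x y.
Proof. by case/imsetP => [[x y]]; rewrite inE /= => xy ->; exists x, y. Qed.

Lemma mem_induced S x y :
  ([set x; y] \in (induced S).2) = [&& adj x y, x \in S & y \in S].
Proof. by rewrite inE mem_edges subUset !sub1set. Qed.

Lemma induced_set2 S f : f \in (induced S).2 ->
  exists x y, [/\ f = [set x; y], adj x y, x \in S & y \in S].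
Proof.
rewrite inE => /andP[/edges_set2[x [y [-> xy]]]].
by rewrite subUset !sub1set => /andP[xS yS]; exists x, y.
Qed.

Lemma edges_inside_induced S : edges_inside (induced S).
Proof. by move=> f; rewrite inE => /andP[]. Qed.

Lemma spath_rev S c : spath S (rev c) = spath S c.
Proof.
rewrite /spath rev_uniq rev_sorted all_rev; congr [&& _, _ & _].
by apply: eq_sorted => x y; rewrite adj_sym.
Qed.

Lemma spath_cat S c d : spath S (c ++ d) -> spath S c /\ spath S d.
Proof.
rewrite /spath cat_uniq all_cat => /and3P[/and3P[-> _ ->] /cat_sorted2[-> ->]].
by case/andP=> -> ->.
Qed.

Lemma spath_rcons S c z y : spath S (rcons c z) -> y \in S -> adj z y ->
  y \notin rcons c z -> spath S (rcons (rcons c z) y).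
Proof.
case/and3P=> u so al yS zy yN.
rewrite /spath rcons_uniq yN u all_rcons al /= yS andbT.
by case: c so {u al yN} => [|x c] /=; rewrite ?rcons_path ?last_rcons ?zy // => ->.
Qed.

(** Greedy extension at the end; it stops because a repetition-free path has at most [#|G|]
    vertices. *)
Lemma spath_saturate S c z : spath S (rcons c z) -> exists b,
  spath S (c ++ z :: b) /\ {in S, forall y, adj (last z b) y -> y \in c ++ z :: b}.
Proof.
have [n] := ubnP (#|G| - size c); elim: n c z => // n IH c z sz sp.
case: (boolP [exists y in S, adj z y && (y \notin rcons c z)]); last first.
  rewrite negb_exists_in => /forall_inP sat; exists [::]; rewrite cats1; split=> //= y yS zy.
  by apply: contraNT (sat y yS) => yN; rewrite zy yN.
case/exists_inP=> y yS /andP[zy yN]; have sp' := spath_rcons sp yS zy yN.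
have szc : size (rcons c z) <= #|G|.
  by have /and3P[u _ _] := sp; rewrite -(card_uniqP u) max_card.
rewrite size_rcons in szc.
have [|b []] := IH (rcons c z) y _ sp'; first by rewrite size_rcons; lia.
by rewrite cat_rcons => spb sat; exists (y :: b).
Qed.

Lemma spath_inner S a u x t b y : spath S (a ++ [:: u, x, t & b]) ->
  #|neighbors S x| <= 2 -> y \in S -> adj x y ->
  [set x; y] \in pedges (a ++ [:: u, x, t & b]).
Proof.
case/spath_cat=> _ /and3P[/= /andP[uN _] /and3P[ux xt _] /and4P[uS xS tS _]] deg yS xy.
have ut : u != t by apply: contraNneq uN => ->; rewrite !inE eqxx orbT.
have [->|yu] := eqVneq y u; first by rewrite setUC mem_pedges_mid.
have [->|yt] := eqVneq y t; first by rewrite -cat_rcons mem_pedges_mid.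
have u3 : uniq [:: u; t; y] by rewrite /= !inE negb_or ut (eq_sym u) yu (eq_sym t) yt.
suff : 2 < #|neighbors S x| by rewrite ltnNge deg.
rewrite -[3]/(size [:: u; t; y]) -(card_uniqP u3); apply/subset_leq_card/subsetP => z.
by rewrite !inE => /or3P[]/eqP->; rewrite ?uS ?tS ?yS // adj_sym.
Qed.

Lemma mem_pedges_join a v b f :
  (f \in pedges (rev a ++ v :: b)) = (f \in pedges (v :: a)) || (f \in pedges (v :: b)).
Proof. by rewrite pedges_cat mem_cat -rev_cons mem_pedges_rev. Qed.

(** * Removing two pendant paths at a common vertex *)

Section TwoPendants.
Variables (S : {set G}) (v w1 w2 : G) (a' b' : seq G).
Let a := w1 :: a'.
Let b := w2 :: b'.
Hypotheses (pa : pendant S v a) (pb : pendant S v b) (w12 : w1 != w2).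
Let S' := S :\: [set x in a ++ b].

Lemma mem_rest x : (x \in S') = (x \notin a ++ b) && (x \in S).
Proof. by rewrite in_setD in_set. Qed.

(** Walk along [b] from [v]. The first vertex on [a] would be reached by an edge of [v :: a] from a
    vertex off [a], that is from [v]; so it is [w2], and the only edge of [v :: a] at [v] goes to
    [w1]. *)
Lemma pendant_disjoint : {in b, forall x, x \notin a}.
Proof.
have [vS ua pta sa ea] := pa; have [_ ub ptb sb _] := pb.
have wN : w2 \notin a.
  apply/negP => wa; case/eqP: w12; apply/esym/(pedges_head ua).
  rewrite setUC; apply: ea => //; rewrite adj_sym.
  by move: ptb => /= /andP[].
have : {subset b <= S} /\ path (@adj G) w2 b' by split=> //; move: ptb => /= /andP[].
move: ub; rewrite /b; elim/last_ind: b' => [|c z IH] ub [sc].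
  by move=> _ x; rewrite inE => /eqP->.
rewrite -!rcons_cons rcons_path => /andP[ptc lz] x.
have {}IH : {in w2 :: c, forall x, x \notin a}.
  apply: IH; last by split=> // y yc; apply: sc; rewrite -rcons_cons mem_rcons inE yc orbT.
  by move: ub; rewrite -!rcons_cons rcons_uniq => /andP[].
rewrite mem_rcons inE => /predU1P[->|/IH //]; apply/negP => za.
have lc : last w2 c \in w2 :: c by apply: mem_last.
have : last w2 c \in v :: a.
  apply: (pedges_sub (f := [set z; last w2 c])); rewrite ?set22 //; apply: ea => //.
    by apply: sc; rewrite -rcons_cons mem_rcons inE lc orbT.
  by rewrite adj_sym.
rewrite inE (negPf (IH _ lc)) orbF => /eqP lv.
by move: ub; rewrite cons_uniq -rcons_cons -lv mem_rcons inE lc orbT.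
Qed.

Lemma pendant_arms : arms (induced S') v a b.
Proof.
have [vS ua _ _ _] := pa; have [_ ub _ _ _] := pb.
have [vNa vNb] : v \notin a /\ v \notin b by move: ua ub; rewrite !(cons_uniq v) => /andP[-> _] /andP[-> _].
split; first by rewrite /= mem_rest mem_cat negb_or vNa vNb.
  move: ub ua; rewrite cat_uniq rev_uniq (cons_uniq v a) => -> /andP[_ ->]; rewrite andTb andbT; apply/hasPn => x.
  by rewrite mem_rev in_cons => /predU1P[->//|]; apply: pendant_disjoint.
by move=> x xab; rewrite /= mem_rest xab.
Qed.

Lemma pendant_nbr x y : x \in a ++ b -> y \in S -> adj x y ->
  [set x; y] \in pedges (rev a ++ v :: b).
Proof.
have [_ _ _ _ ea] := pa; have [_ _ _ _ eb] := pb.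
rewrite mem_pedges_join mem_cat => /orP[xa|xb] yS xy; first by rewrite ea.
by rewrite eb // orbT.
Qed.

Lemma pendant_nbr_out x y : x \in a ++ b -> y \in S' -> adj x y -> y = v.
Proof.
move=> xab; rewrite mem_rest => /andP[yN yS] /(pendant_nbr xab yS)/pedges_sub sub.
have := sub y (set22 _ _); rewrite mem_cat mem_rev (in_cons v) orbCA -mem_cat (negPf yN) orbF.
by move/eqP.
Qed.

Lemma induced_pendants :
  induced S = union_graph (induced S') (path_graph (rev a ++ v :: b)).
Proof.
have [vS ua pta sa ea] := pa; have [_ ub ptb sb _] := pb.
have sab x : x \in a ++ b -> x \in S by rewrite mem_cat => /orP[/sa|/sb].
apply: injective_projections; apply/setP; [move=> x|move=> f].
  change ((x \in S) = (x \in S' :|: [set y in rev a ++ v :: b])).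
  rewrite in_setU mem_rest in_set.
  rewrite [x \in rev a ++ _]mem_cat mem_rev (in_cons v) (orbCA (x \in a)) -mem_cat.
  case: (boolP (x \in a ++ b)) => [/sab->|_]; rewrite ?orbT ?orbF //=.
  by case: eqVneq => [->|_]; rewrite ?orbF // vS.
rewrite [RHS]inE mem_path_graph; apply/idP/orP => [/induced_set2|].
  case=> [x [y [-> xy xS yS]]].
  case: (boolP (x \in a ++ b)) => [xab|xN]; first by right; apply: pendant_nbr.
  case: (boolP (y \in a ++ b)) => [yab|yN].
    by right; rewrite setUC; apply: pendant_nbr; rewrite // adj_sym.
  by left; rewrite mem_induced xy !mem_rest xN yN xS yS.
have arm c : pendant S v c -> {subset pedges (v :: c) <= (induced S).2}.
  case=> _ _ ptc sc _ g /pedgesP[d [x [y [e [cE ->]]]]].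
  have sub z : z \in v :: c -> z \in S by rewrite inE => /predU1P[->|/sc].
  rewrite mem_induced !sub ?cE ?mem_cat ?inE ?eqxx ?orbT // !andbT.
  have : sorted (@adj G) (v :: c) by [].
  by rewrite cE => /cat_sorted2[_ /= /andP[]].
case=> [/induced_set2[x [y [-> xy]]]|].
  by rewrite !mem_rest mem_induced xy => /andP[_ ->] /andP[_ ->].
by rewrite mem_pedges_join => /orP[]; apply: arm.
Qed.

(** Let [A] be closed in [S']. If [v] is in [A], then [A] together with both pendant paths is closed
    in [S]; otherwise [A] itself is closed in [S], hence all of [S], and contains [v] after all. *)
Lemma connected_pendants : connected_in S -> connected_in S'.
Proof.
case=> _ cS; have [vS' _ _] := pendant_arms.
split; first by apply/set0Pn; exists v.
move=> A A0 AS' cl; have AS : A \subset S by apply: subset_trans AS' (subsetDl _ _).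
have S'N x : x \in S -> x \notin a ++ b -> x \in S' by move=> xS xN; rewrite mem_rest xN.
case: (boolP (v \in A)) => vA; last first.
  case/negP: (vA); rewrite (cS A) //; first by case: pa.
  move=> x y xA yS xy; case: (boolP (y \in a ++ b)) => [yab|yN].
    case/negP: (vA); rewrite -(pendant_nbr_out yab (y := x)) //; first exact: (subsetP AS').
    by rewrite adj_sym.
  by apply: cl xy; rewrite ?S'N.
apply/setP => x; case: (boolP (x \in S')) => xS'; last by apply: contraNF xS' => /(subsetP AS').
have : x \in A :|: [set x in a ++ b].
  rewrite (cS (A :|: [set x in a ++ b])) //.
  - by move: xS'; rewrite mem_rest => /andP[].
  - by apply/set0Pn; exists v; rewrite inE vA.
  - apply/subsetP => y; rewrite in_setU in_set => /orP[/(subsetP AS)//|].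
    by rewrite mem_cat => /orP[]; [case: pa | case: pb] => _ _ _ s _ /s.
  move=> y z; rewrite !in_setU !in_set => yA zS yz.
  case: (boolP (z \in a ++ b)) => [|zN]; rewrite ?orbT // orbF.
  case/orP: yA => [yA|yab]; first by apply: cl yz; rewrite ?S'N.
  by rewrite (pendant_nbr_out yab _ yz) ?S'N.
by move: xS'; rewrite mem_rest in_setU in_set => /andP[/negPf-> _]; rewrite orbF.
Qed.

(** Only [v] loses neighbours, and it loses exactly [w1] and [w2]. *)
Lemma odd_neighbors_pendants x : x \in S' ->
  odd #|neighbors S' x| = odd #|neighbors S x|.
Proof.
move=> xS'; have [vS ua pta sa ea] := pa; have [_ ub ptb sb eb] := pb.
have S'N y : y \in S -> y \notin a ++ b -> y \in S' by move=> yS yN; rewrite mem_rest yN.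
have [xv|xv] := eqVneq x v; last first.
  congr (odd #|pred_of_set _|); apply/setP => y; rewrite !mem_neighbors mem_rest.
  case: (boolP (y \in a ++ b)) => //= yab; symmetry; apply/negP => /andP[yS xy].
  by case/eqP: xv; apply: (pendant_nbr_out yab xS'); rewrite adj_sym.
have vw1 : adj v w1 by move: pta => /= /andP[].
have vw2 : adj v w2 by move: ptb => /= /andP[].
have -> : neighbors S x = w1 |: (w2 |: neighbors S' x).
  rewrite xv; apply/setP => y; rewrite !in_setU !in_set1 !mem_neighbors mem_rest.
  have [->|y1] := eqVneq y w1; first by rewrite vw1 sa ?mem_head.
  have [->|y2] := eqVneq y w2; first by rewrite vw2 sb ?mem_head.
  case: (boolP (y \in a ++ b)) => // yab; rewrite mem_cat in yab; rewrite [RHS]/=.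
  apply/negP => /andP[yS vy]; case/orP: yab => yab.
    by case/eqP: y1; apply: (pedges_head ua); rewrite setUC ea // adj_sym.
  by case/eqP: y2; apply: (pedges_head ub); rewrite setUC eb // adj_sym.
rewrite !cardsU1 in_setU in_set1 (negPf w12) !mem_neighbors !mem_rest !mem_cat !mem_head orbT /=.
by rewrite negbK.
Qed.

End TwoPendants.

Lemma pendant_last S v s z : pendant S v (rcons s z) -> #|neighbors S z| = 1.
Proof.
case=> vS u; rewrite rcons_path => /andP[_ lz] sub e.
suff -> : neighbors S z = [set last v s] by rewrite cards1.
have zs : z \in rcons s z by rewrite mem_rcons mem_head.
apply/setP => y; rewrite !inE; apply/andP/eqP => [[yS zy]|->].
  have := e z y zs yS zy; rewrite -rcons_cons => /pedges_last.
  by rewrite rcons_cons => /(_ u) [_ ->].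
split; last by rewrite adj_sym.
have := mem_last v s; rewrite inE => /predU1P[->//|ls].
by apply: sub; rewrite mem_rcons inE ls orbT.
Qed.

End InducedSubgraphs.

(** * Paths and branch vertices in acyclic graphs *)

Section AcyclicStructure.
Variable G : sgraph.
Implicit Types (S : {set G}) (x y z v w : G) (s c : seq G).
Hypothesis acyclicG : acyclic G.

(** A neighbour of [z] on the path other than its predecessor would close a cycle. As [c] contains
    [y] it is non-empty, so the default in [last y c] is never reached. *)
Lemma spath_last_neighbor S c z y :
  spath S (rcons c z) -> y \in rcons c z -> adj z y -> y \in c /\ y = last y c.
Proof.
move=> sp yc zy; have {}yc : y \in c.
  by move: yc; rewrite mem_rcons inE eq_sym (negPf (adj_neq zy)).
split=> //; case/splitPr: yc sp => a b; rewrite last_cat /= rcons_cat.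
case: b => [//|t b] /spath_cat[_ /and3P[u so _]].
have /negP[] := acyclicG (y :: rcons (t :: b) z); rewrite u /= size_rcons /=.
move: so; rewrite /= !rcons_path last_rcons zy andbT.
by case/andP=> -> ->.
Qed.

Lemma spath_last_edge S c z y :
  spath S (rcons c z) -> y \in rcons c z -> adj z y -> [set z; y] \in pedges (rcons c z).
Proof.
move=> sp yc zy; have [yc' yl] := spath_last_neighbor sp yc zy.
case/lastP: c yc' yl {sp yc} => // c u _; rewrite last_rcons => <-.
by rewrite setUC -!cats1 -catA mem_pedges_mid.
Qed.

(** At inner vertices the degree bound leaves no room for another edge; at the ends acyclicity
    forbids chords. *)
Lemma spath_closed S c : spath S c ->
  {in c, forall x, #|neighbors S x| <= 2} ->
  {in S, forall y x d, c = x :: d -> adj x y -> y \in c} ->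
  {in S, forall y x d, c = rcons d x -> adj x y -> y \in c} ->
  forall x y, x \in c -> y \in S -> adj x y -> [set x; y] \in pedges c.
Proof.
move=> sp deg hd lt x y xc yS xy; case/splitPr: xc sp deg hd lt => a b sp deg hd lt.
case: b sp deg hd lt => [|t b].
  rewrite cats1 => sp deg hd lt; apply: spath_last_edge sp _ (xy).
  exact: (lt y yS x a erefl xy).
case/lastP: a => [|a u] sp deg hd lt; last first.
  rewrite cat_rcons in sp deg *; apply: spath_inner yS xy => //.
  by apply: deg; rewrite mem_cat !inE eqxx !orbT.
rewrite -mem_pedges_rev rev_cons; apply: (@spath_last_edge S); rewrite -?rev_cons ?spath_rev //.
by rewrite mem_rev; apply: (hd y yS x _ erefl xy).
Qed.

(** A path from any vertex is saturated in one direction, reversed and saturated in the other. Its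
    vertex set is then closed under adjacency, so it is [S]. *)
Lemma induced_is_path S : connected_in S -> {in S, forall x, #|neighbors S x| <= 2} ->
  exists c, spath S c /\ induced S = path_graph c.
Proof.
case=> /set0Pn[r rS] cS deg.
have [|b [sp1 sat1]] := @spath_saturate _ S [::] r; first by rewrite /spath /= rS.
have [|d [sp2 sat2]] := @spath_saturate _ S (rev b) r.
  by rewrite -rev_cons spath_rev.
set c := rev b ++ r :: d in sp2 sat2; exists c; split=> //.
have sub : {subset c <= S} by have /and3P[_ _ /allP] := sp2.
have closed x y : x \in c -> y \in S -> adj x y -> [set x; y] \in pedges c.
  apply: spath_closed sp2 _ _ _ x y => [x /sub/deg//|y yS x e cE xy|y yS x e cE xy].
    have : y \in r :: b.
      apply: sat1 => //; move: cE; rewrite /c; case/lastP: (b) => [|b' u]; first by case=> ->.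
      by rewrite last_rcons rev_rcons => -[->].
    by rewrite /c mem_cat mem_rev !inE => /orP[]->; rewrite ?orbT.
  apply: sat2 => //; suff -> : last r d = x by [].
  by have := congr1 (last r) cE; rewrite /c last_cat last_rcons.
have SE : [set x in c] = S.
  apply: cS => [||x y]; first by apply/set0Pn; exists r; rewrite inE mem_cat mem_head orbT.
    by apply/subsetP => x; rewrite inE => /sub.
  by rewrite !inE => xc yS /(closed x y xc yS)/pedges_sub; apply; rewrite set22.
apply: injective_projections => //=; apply/setP => f.
rewrite mem_path_graph; apply/idP/idP => [fS|].
  have [x [y [-> xy xS yS]]] := induced_set2 fS.
  by apply: closed => //; rewrite -SE inE in xS.
case/pedgesP=> [a [x [y [e [cE ->]]]]]; have /and3P[_ so _] := sp2.
rewrite -[_ \in _]/(_ \in (induced S).2) mem_induced !sub ?cE ?mem_cat ?inE ?eqxx ?orbT // !andbT.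
by move: so; rewrite cE => /cat_sorted2[_ /= /andP[]].
Qed.

(* The branch vertex is chosen at the end of a longest possible path, so that
   no vertex beyond it branches again. *)
Lemma deepest_branch S x0 : x0 \in S -> 2 < #|neighbors S x0| ->
  exists v (N : {set G}), [/\ 2 < #|neighbors S v|, #|neighbors S v| <= #|N|.+1
    & {in N, forall w, exists s, pendant S v (w :: s)}].
Proof.
move=> x0S deg0.
pose P n := [exists c : n.-tuple G, exists x, spath S (rcons c x) && (2 < #|neighbors S x|)].
have exP : exists n, P n.
  by exists 0; apply/existsP; exists [tuple]; apply/existsP; exists x0; rewrite /spath /= x0S deg0.
have ubP n : P n -> n <= #|G|.
  case/existsP=> c /existsP[x /andP[/and3P[u _ _] _]].
  rewrite -(size_tuple c); apply: leq_trans (max_card (mem (rcons c x))).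
  by rewrite (card_uniqP u) size_rcons.
case: (ex_maxnP exP ubP) => n /existsP[c /existsP[v /andP[sp degv]]] maxn.
have max c' x : n < size c' -> spath S (rcons c' x) -> #|neighbors S x| <= 2.
  move=> nc' spx; rewrite leqNgt; apply: contraTN nc' => degx; rewrite -leqNgt.
  by apply: maxn; apply/existsP; exists (in_tuple c'); apply/existsP; exists x; rewrite spx.
(* The candidates are the neighbours of [v] off the longest path; at most one neighbour, the
   predecessor of [v], is excluded. *)
exists v, (neighbors S v :\: [set x in rcons c v]); split=> //.
  rewrite -(cardsID [set x in rcons c v]) -add1n leq_add2r.
  apply/card_le1_eqP => y1 y2; rewrite !inE => /andP[/andP[_ vy1] y1c] /andP[/andP[_ vy2] y2c].
  have [y1c' ->] := spath_last_neighbor sp y1c vy1.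
  have [_ ->] := spath_last_neighbor sp y2c vy2.
  by case: (tval c) y1c'.
move=> w; rewrite !inE => /andP[wN /andP[wS vw]].
have spw := spath_rcons sp wS vw wN.
have [s] := spath_saturate spw; rewrite cat_rcons => -[spx sat]; exists s.
have [_ /and3P[us so /allP al]] := spath_cat spx.
split=> //; first by apply: al; rewrite mem_head.
  by move=> x xs; apply: al; rewrite inE xs orbT.
move=> x y xs yS xy; case/splitPr E : _ / xs => [a b].
have lc d : (tval c ++ v :: a) ++ d = c ++ v :: (a ++ d) by rewrite -catA.
rewrite E -lc in spx sat.
(* The path up to [x] runs through [v], so it is longer than the maximal one leading to a branch
   vertex. *)
have degx : #|neighbors S x| <= 2.
  apply: (max (tval c ++ v :: a)); first by rewrite size_cat size_tuple addnS leq_addr.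
  by move: spx; rewrite -(cat_rcons x) => /spath_cat[].
(* At the far end, saturation keeps all neighbours on the path and acyclicity leaves only the
   predecessor; elsewhere the degree bound suffices. *)
case: b E spx sat => [|t b] E spx sat.
  rewrite cats1 in spx; rewrite -cat_cons cats1.
  have yin : y \in rcons (tval c ++ v :: a) x.
    rewrite -cats1; apply: sat => //; suff -> : last w s = x by [].
    by have := congr1 (last v) E; rewrite /= last_cat.
  have [_ yl] := spath_last_neighbor spx yin xy.
  rewrite last_cat /= in yl; rewrite lastI -yl.
  by rewrite setUC -!cats1 -catA mem_pedges_mid.
rewrite -cat_cons lastI cat_rcons; apply: spath_inner degx yS xy.
by move: spx; rewrite -catA lastI cat_rcons => /spath_cat[].
Qed.

End AcyclicStructure.

(** * Induction for trees whose odd vertices are pairwise at distance at least 3 *)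

Section SparseOddVertices.
Variables (G : sgraph) (odd_set : {pred G}).
Implicit Types (S : {set G}) (x y z v w : G) (s a b : seq G).
Hypothesis acyclicG : acyclic G.
Hypothesis far_adj : {in odd_set &, forall x y, x != y -> ~~ adj x y}.
Hypothesis far_two : {in odd_set &, forall x y z, x != y -> adj x z -> ~~ adj z y}.

(** [odd_set] stays fixed while [S] shrinks, so the colouring is the same at every stage of the
    induction. *)
Definition parity_in S := {in S, forall x, odd #|neighbors S x| = (x \in odd_set)}.

Lemma adj_even x y : x \in odd_set -> adj x y -> y \notin odd_set.
Proof. by move=> xO xy; apply/negP => yO; have /negP := far_adj xO yO (adj_neq xy). Qed.

Lemma even_two x y z : x \in odd_set -> adj x y -> adj y z -> x != z -> z \notin odd_set.
Proof. by move=> xO xy yz xz; apply/negP => zO; have /negP := far_two xO zO xz xy. Qed.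

Lemma pendant_last_odd S v s z : parity_in S -> pendant S v (rcons s z) -> z \in odd_set.
Proof.
move=> par p; rewrite -par ?(pendant_last p) //; case: p => _ _ _ sub _.
by apply: sub; rewrite mem_rcons mem_head.
Qed.

(** The last vertex of a pendant path is a leaf, hence odd, so every other vertex within distance 2
    of it is even. This fixes the colours here and in the two lemmas that follow. *)
Lemma pendant1 S v x : parity_in S -> pendant S v [:: x] ->
  [/\ x \in odd_set, adj v x & v \notin odd_set].
Proof.
move=> par p; have xO := pendant_last_odd par (p : pendant S v (rcons [::] x)).
have [_ _ /= /andP[vx _] _ _] := p; split=> //.
by apply: adj_even xO _; rewrite adj_sym.
Qed.

Lemma pendant2 S v x y : parity_in S -> pendant S v [:: x; y] ->
  map (odd_color odd_set) [:: x; y] = [:: red; black] /\ v \notin odd_set.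
Proof.
move=> par p; have yO := pendant_last_odd par (p : pendant S v (rcons [:: x] y)).
have [_ /= /andP[vN _] /and3P[vx xy _] _ _] := p.
have xN : x \notin odd_set by apply: adj_even yO _; rewrite adj_sym.
rewrite /odd_color (negPf xN) yO; split=> //.
apply: (even_two (y := x)) yO _ _ _; rewrite 1?adj_sym //.
by apply: contraNneq vN => ->; rewrite !inE eqxx orbT.
Qed.

Lemma pendant3 S v x y z : parity_in S -> pendant S v [:: x; y; z] ->
  map (odd_color odd_set) [:: x; y; z] = [:: red; red; black].
Proof.
move=> par p; have zO := pendant_last_odd par (p : pendant S v (rcons [:: x; y] z)).
have [_ /= /and3P[_ xN _] /and4P[vx xy yz _] _ _] := p.
have yN : y \notin odd_set by apply: adj_even zO _; rewrite adj_sym.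
rewrite /odd_color (negPf yN) zO ifN //.
apply: (even_two (y := y)) zO _ _ _; rewrite 1?adj_sym //.
by apply: contraNneq xN => ->; rewrite !inE eqxx orbT.
Qed.

(** The pendant paths have lengths [size a + 1] and [size b + 1], so the bounds say that both
    lengths are at least 3 for odd [v], and that their sum is at least 4 for even [v]. *)
Lemma removable_pendants S x : parity_in S -> x \in S -> 2 < #|neighbors S x| ->
  exists v w1 w2 a b, [/\ pendant S v (w1 :: a), pendant S v (w2 :: b), w1 != w2,
    size b <= size a & if v \in odd_set then 1 < size b else 1 < size a + size b].
Proof.
move=> par xS degx; have [v [N [degv szN pN]]] := deepest_branch acyclicG xS degx.
suff [w1 [w2 [a [b [pa pb w12 sz]]]]] : exists w1 w2 a b,
    [/\ pendant S v (w1 :: a), pendant S v (w2 :: b), w1 != w2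
      & if v \in odd_set then 1 < size b /\ 1 < size a else 1 < size a + size b].
  have [ba|ab] := leqP (size b) (size a).
    by exists v, w1, w2, a, b; split=> //; case: ifP sz => // _ [].
  exists v, w2, w1, b, a; split=> //; first by rewrite eq_sym.
    exact: ltnW.
  by case: ifP sz => [_ []//|_]; rewrite addnC.
have [vO|vN] := boolP (v \in odd_set).
  have : 1 < #|N| by lia.
  case/card_gt1P=> w1 [w2 [/pN[a pa] /pN[b pb] w12]]; exists w1, w2, a, b; split=> //.
  have long w s : pendant S v (w :: s) -> 1 < size s.
    case: s => [|y []] // p; first by have [_ _ /negP] := pendant1 par p.
    by have [_ /negP] := pendant2 par p.
  by split; apply: long; eassumption.
(* An even degree above 2 is at least 4, which leaves three pendant paths to choose from. *)
have : 2 < #|N|.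
  have vS : v \in S.
    have /card_gt0P[w /pN[s []]] // : 0 < #|N| by lia.
  have := par v vS; rewrite (negPf vN) => ev.
  suff : #|neighbors S v| != 3 by lia.
  by apply: contraFneq ev => ->.
case/card_gt2P=> w1 [w2 [w3 [[/pN[a pa] /pN[b pb] /pN[c pc]] [w12 w23 w31]]]].
(* Two pendant edges at [v] would put two odd leaves at distance 2. *)
have long w w' s s' : pendant S v (w :: s) -> pendant S v (w' :: s') -> w != w' ->
    0 < size s + size s'.
  case: s => [|//] p; case: s' => [|//] p' ww'; have [wO vw _] := pendant1 par p.
  have [w'O vw' _] := pendant1 par p'.
  by have := even_two wO _ vw' ww'; rewrite adj_sym w'O => /(_ vw).
have lab := long _ _ _ _ pa pb w12; have lbc := long _ _ _ _ pb pc w23.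
have lca := long _ _ _ _ pc pa w31.
case: (ltnP 1 (size a + size b)) => ab; first by exists w1, w2, a, b.
case: (ltnP 1 (size b + size c)) => bc; first by exists w2, w3, b, c.
(* If both earlier pairs have total size 1, then [b] has size 0 and [a], [c] have size 1. *)
exists w3, w1, c, a; split=> //; lia.
Qed.

(** The ends of a path with an edge are odd, so lengths 1 and 2 contradict sparsity. Length 3 is the
    base skeleton, a longer path decomposes as itself, and without edges the empty decomposition
    works. *)
Lemma path_case S s : parity_in S -> spath S s -> induced S = path_graph s ->
  long_dec (induced S) \/ skel odd_set (induced S).
Proof.
move=> par sp SE; have /and3P[us so al] := sp.
have head_odd x y b : spath S [:: x, y & b] -> induced S = path_graph [:: x, y & b] ->
    x \in odd_set.
  move=> /and3P[u /= /andP[xy _] /and3P[xS yS _]] E; rewrite -par //.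
  suff -> : neighbors S x = [set y] by rewrite cards1.
  apply/setP => z; rewrite mem_neighbors in_set1; apply/andP/eqP => [[zS xz]|->//].
  by apply: (pedges_head u); rewrite -mem_path_graph -E mem_induced xz xS.
have last_odd x y b : s = rcons (rcons b y) x -> x \in odd_set.
  move=> sE; apply: (head_odd x y (rev b)).
    by rewrite -!rev_rcons spath_rev -sE.
  by rewrite -!rev_rcons path_graph_rev -sE.
have dec L : long_paths L -> flatten (map (@pedges G) L) = pedges s -> long_dec (induced S).
  move=> gL LE; exists L => //; rewrite /edge_partition LE; apply: uniq_perm.
  - exact: uniq_pedges.
  - exact: enum_uniq.
  by move=> f; rewrite mem_enum SE mem_path_graph.
case: s us so al sp SE last_odd dec => [|x0 [|x1 s]] us so al sp SE last_odd dec.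
- by left; apply: (dec [::]).
- by left; apply: (dec [::]).
have x0O := head_odd _ _ _ sp SE; case: s us so al sp SE last_odd dec => [|x2 s] us so al sp SE last_odd dec.
  have x1O := last_odd x1 x0 [::] erefl; move: so => /= /andP[x01 _].
  by have := adj_even x0O x01; rewrite x1O.
case: s us so al sp SE last_odd dec => [|x3 s] us so al sp SE last_odd dec.
  have x2O := last_odd x2 x1 [:: x0] erefl; move: so => /= /and3P[x01 x12 _].
  have x02 : x0 != x2 by move: us; rewrite /= !inE !negb_or => /andP[/andP[]].
  by have := even_two x0O x01 x12 x02; rewrite x2O.
case: s us so al sp SE last_odd dec => [|x4 s] us so al sp SE last_odd dec.
  have x3O := last_odd x3 x2 [:: x0; x1] erefl; move: so => /= /and4P[x01 x12 x23 _].
  have x1N := adj_even x0O x01; have x2N : x2 \notin odd_set.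
    by apply: adj_even x3O _; rewrite adj_sym.
  right; rewrite SE; apply: skel_base => //.
  by rewrite /= /odd_color x0O x3O (negPf x1N) (negPf x2N).
left; apply: (dec [:: [:: x0, x1, x2, x3, x4 & s]]); last exact: cats0.
by rewrite /long_paths /all us.
Qed.

Lemma long_dec_or_skel S : connected_in S -> parity_in S ->
  long_dec (induced S) \/ skel odd_set (induced S).
Proof.
have [n] := ubnP #|S|; elim: n S => // n IH S Sn cS par.
case: (boolP [exists x in S, 2 < #|neighbors S x|]); last first.
  rewrite negb_exists_in => /forall_inP deg.
  have [|s [sp SE]] := induced_is_path acyclicG cS; last exact: path_case par sp SE.
  by move=> x /deg; rewrite -leqNgt.
case/exists_inP=> x xS degx.
have [v [w1 [w2 [a' [b' [pa pb w12 szab sz]]]]]] := removable_pendants par xS degx.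
set a := w1 :: a' in pa; set b := w2 :: b' in pb.
have A := pendant_arms pa pb w12; have E := induced_pendants pa pb.
have cS' := connected_pendants pa pb w12 cS.
have odd' := odd_neighbors_pendants pa pb w12.
set S' := S :\: _ in A E cS' odd'.
have par' : parity_in S'.
  by move=> y yS'; rewrite odd' //; apply: par; move: yS'; rewrite inE => /andP[].
have HH := @edges_inside_induced G S'.
have lt : #|S'| < n.
  rewrite ltnS in Sn; apply: leq_trans Sn; apply/proper_card/properP; split; first exact: subsetDl.
  exists w1; first by case: pa => _ _ _ sub _; apply: sub; rewrite mem_head.
  by rewrite inE inE mem_cat mem_head.
rewrite E; have [dec|sk] := IH S' lt cS' par'.
  (* For either parity of [v] the joined path [rev a ++ v :: b] has length at least 4. *)
  by left; apply: (long_dec_extend HH A) dec; rewrite /=; case: ifP sz; lia.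
have [_ sh bl] := skel_properties sk; have [vS' us D] := A.
have att := @arms_attach _ odd_set _ _ _ _ A; have shv := sh v vS'.
case: ifP sz => [vO sz|/negbT vN sz].
  case: (ltnP 2 (size a')) => sa.
    by left; apply: (long_dec_black HH A vO shv).
  (* Both pendant paths now have length exactly 3, so together they form a 6-path with black joint
     [v]. *)
  right; apply: skel_attach sk (att _); right; split=> //.
    have : size a' = 2 by lia.
    by move: pa; rewrite /a; case: (a') => [|? [|? []]] // p _; apply: pendant3 par p.
  have : size b' = 2 by lia.
  by move: pb; rewrite /b; case: (b') => [|? [|? []]] // p _; apply: pendant3 par p.
have [b0|b1] := posnP (size b').
  (* The leaf [w2] is odd and adjacent to [v], while the red vertex [v] has a black neighbour [c] in
     the skeleton: two odd vertices at distance 2. *)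
  have pw : pendant S v [:: w2] by rewrite -(size0nil b0).
  have [w2O vw2 _] := pendant1 par pw.
  have [c cO /andP[cS'1]] := bl v vS' vN; rewrite mem_induced => /and3P[vc _ _].
  have /negP[] : c \notin odd_set; last by [].
  apply: even_two w2O _ vc _; first by rewrite adj_sym.
  by apply: contraTneq cS'1 => <-; apply: D; rewrite mem_cat mem_head orbT.
case: (ltnP 1 (size a')) => sa.
  by left; apply: (long_dec_red HH A vN shv).
(* Both lengths are exactly 2, giving a 4-path with red joint [v]. *)
right; apply: skel_attach sk (att _); left; split=> //.
  have : size a' = 1 by lia.
  by move: pa; rewrite /a; case: (a') => [|? []] // p _; have [] := pendant2 par p.
have : size b' = 1 by lia.
by move: pb; rewrite /b; case: (b') => [|? []] // p _; have [] := pendant2 par p.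
Qed.

End SparseOddVertices.

(** * From odd distance to sparsity, and the theorem *)

Lemma dist_le (G : sgraph) (x y : G) p :
  path (@adj G) x p -> last x p = y -> uniq (x :: p) -> dist x y <= size p.
Proof.
move=> ptp lp up; rewrite leqNgt; apply/negP => lt.
(* [find] never exceeds the length [#|G|] of the searched list, so [size p] is among the lengths
   tried. *)
have szp : size p < #|G|.
  by have := leq_trans lt (find_size _ _); rewrite size_iota.
have := before_find 0 lt; rewrite nth_iota //= add0n => /existsP[].
by exists (in_tuple p); rewrite ptp lp eqxx.
Qed.

Lemma odd_dist_ge (G : sgraph) k (x y : G) : odd_distance_geq G k ->
  odd_vertex x -> odd_vertex y -> x != y -> k <= dist x y.
Proof.
rewrite /odd_distance_geq /odd_distance => + xO yO xy.
have oxy : odd_pair (x, y) by rewrite /odd_pair xO yO.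
case: pickP => [p0 op0|/(_ (x, y))]; last by rewrite oxy.
by case: arg_minnP => // p _ /(_ _ oxy) minp kp; apply: leq_trans kp minp.
Qed.

Lemma connected_in_setT (G : sgraph) : connected G -> connected_in [set: G].
Proof.
case=> /card_gt0P[r _] cG; split; first by apply/set0Pn; exists r.
move=> A /set0Pn[x xA] _ cl; apply/setP => y; rewrite inE.
have /connectP[p ptp ->] := cG x y.
elim: p x xA ptp => [|z p IH] x xA //= /andP[xz]; apply: IH.
by apply: cl xz; rewrite ?inE.
Qed.

Theorem theorem2 (T : sgraph) :
  is_tree T -> in_calG T -> has_4pc_decomposition T \/ is_skeleton T.
Proof.
move=> treeT [cT _ farT]; have [_ acT] := treeT.
have wholeE : induced [set: T] = whole_graph T.
  by congr pair; apply/setP => f; rewrite inE subsetT andbT.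
have par : parity_in (@odd_vertex T) [set: T].
  by move=> x _; congr (odd #|pred_of_set _|); apply/setP => y; rewrite !inE.
(* An edge, or a path with two edges, between distinct odd vertices would bound their distance by 1
   or 2. *)
have far1 : {in @odd_vertex T &, forall x y, x != y -> ~~ adj x y}.
  move=> x y xO yO xy; apply/negP => axy.
  have := odd_dist_ge farT xO yO xy; rewrite leqNgt ltnS => /negP[].
  by apply: leq_trans (@dist_le T x y [:: y] _ _ _) _; rewrite //= ?axy ?inE ?xy.
have far2 : {in @odd_vertex T &, forall x y z, x != y -> adj x z -> ~~ adj z y}.
  move=> x y xO yO z xy axz; apply/negP => azy.
  have := odd_dist_ge farT xO yO xy; rewrite leqNgt ltnS => /negP[].
  apply: (@dist_le T x y [:: z; y]); rewrite //= ?axz ?azy // !inE negb_or xy.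
  by rewrite (adj_neq axz) (adj_neq azy).
have := long_dec_or_skel acT far1 far2 (connected_in_setT cT) par.
rewrite wholeE => -[/long_dec_4pc|/skel_chain]; first by left.
by move=> [t [Ts [Ps TsP]]]; right; split=> //; exists (odd_color (@odd_vertex T)), t, Ts, Ps.
Qed.
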